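(* Let $I\subset\mathbb R$ be a non-degenerate interval, let $N\ge 1$ be an integer and let $a_0,\ldots,a_N\in\mathbb R$ with $a_0\ne 0$ and $a_N\neq 0$. Assume that $$\mathcal R(a_N,\ldots,a_0)=\{(r_1,k_1),(r_2,k_2),(\lambda_1,l_1),\ldots,(\lambda_p,l_p)\},$$ that $$|r_1|<|\lambda_1|\le\ldots\le|\lambda_p|<|r_2|,$$ and that $r_1,r_2$ are real with $r_1r_2<0$. Let $j\in\{1,2\}$ be the index of the negative number among $r_1$ and $r_2$. Let $b_Mr^M+\ldots+b_1r+b_0$ be a polynomial with real coefficients, $b_M\ne0$, such that: (i) in the case where $r_1\neq1$ and $r_2\ne 1$, $$\mathcal R(b_M,\ldots,b_0)=\{(r_j,k_j),(\lambda_1,l_1),\ldots,(\lambda_p,l_p)\};$$ (ii) in the case where the positive number among $r_1$ and $r_2$ equals $1$, $$\mathcal R(b_M,\ldots,b_0)=\{(1,1),(r_j,k_j),(\lambda_1,l_1),\ldots,(\lambda_p,l_p)\}.$$ Then a continuous decreasing surjection $g\colon I\to I$ satisfies $$a_Ng^N(x)+\ldots+a_1g(x)+a_0x=0\quad\text{for all }x\in I$$ if and only if it satisfies $$b_Mg^M(x)+\ldots+b_1g(x)+b_0x=0\quad\text{for all }x\in I.$$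
   Context: $g^n$ denotes the $n$-th iterate of $g$. For real numbers $c_0,\ldots,c_K$ with $c_K\neq0$, $\mathcal R(c_K,\ldots,c_0)$ denotes the set $\{(r_1,k_1),\ldots,(r_s,k_s)\}$ of all pairs consisting of a complex root of the polynomial $c_Kr^K+\ldots+c_1r+c_0$ and its multiplicity, where $r_1,\ldots,r_s$ are the pairwise distinct complex roots. The $\lambda_i$ are complex numbers (real or not). Here $p\ge 0$; for $p=0$ the inequality chain reads $|r_1|<|r_2|$. *)

(* Defs.v *)
From HB Require Import structures.
From mathcomp Require Import all_boot all_order all_algebra.
From mathcomp Require Import all_classical all_reals all_analysis.
From mathcomp Require Import complex.

Set Implicit Arguments.
Unset Strict Implicit.
Unset Printing Implicit Defensive.

Import Order.TTheory GRing.Theory Num.Theory.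
Import numFieldNormedType.Exports.

Local Open Scope classical_set_scope.
Local Open Scope ring_scope.
Local Open Scope complex_scope.

(* The set of pairs (root, multiplicity) of c_K r^K + ... + c_1 r + c_0 over
   the complex numbers; only the values c 0, ..., c K are used, and the notion
   is meaningful when c K != 0 (mup is only significant for a nonzero
   polynomial). *)
Definition roots_mult (R : realType) (K : nat) (c : nat -> R) :
    set (R[i] * nat) :=
  let P := map_poly (real_complex R) (\poly_(i < K.+1) c i) in
  [set zm | root P zm.1 /\ zm.2 = mup zm.1 P].

Definition iterative_eq (R : realType) (I : set R) (K : nat) (c : nat -> R)
    (g : R -> R) : Prop :=
  forall x, I x -> \sum_(i < K.+1) c i * iter i g x = 0.

(* A self-map of I is represented by a function on R, of which only the values
   on I matter.  Monotonicity is in the weak sense: a surjection solving either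
   of the equations under study is injective on I, so that the strict sense
   would select the same solutions. *)
Definition continuous_decreasing_surjection (R : realType) (I : set R)
    (g : R -> R) : Prop :=
  [/\ set_fun I I g, set_surj I I g, {within I, continuous g} &
      forall x y, I x -> I y -> x <= y -> g y <= g x].

(* Main.v *)
(* Let [S u = u \o g].  The equations say that the characteristic polynomial,
   evaluated at [S], kills the inclusion of [I] in the reals.  As [g] is
   antitone, [d := g - id] satisfies [d * (d \o g) <= 0], so [d] alternates in
   sign along the orbits.  Let [r] be the positive one among the roots [r1] and
   [r2], and suppose that [r] is strictly largest in modulus.  By Bezout,
   [d = u + v] with [u] in the kernel of [(S - r)^k] and [v] in that of the
   cofactor.  Along an orbit, [v] is [o(r^n)], while [u], if nonzero, eventually
   exceeds [r^n] up to a constant factor in a fixed complex direction; this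
   would prevent [d] from alternating, so [u = 0] and the cofactor already kills
   [d = (S - 1) id].  If [r] is strictly smallest in modulus, run the same
   argument along backward orbits, with inverted roots.  Finally [S - 1] is
   removed by coprimality with [(S - r)^k] when [r <> 1], and kept otherwise. *)

Require Import Defs.
From mathcomp Require Import all_boot all_order all_algebra.
From mathcomp Require Import all_classical all_reals all_analysis.
From mathcomp Require Import complex.
From mathcomp Require Import ring lra.

Set Implicit Arguments.
Unset Strict Implicit.
Unset Printing Implicit Defensive.

Import Order.TTheory GRing.Theory Num.Theory.
Import numFieldNormedType.Exports.

Local Open Scope classical_set_scope.
Local Open Scope ring_scope.
Local Open Scope complex_scope.

(** * Polynomials acting by composition *)

(* [act g p u] is [p(S) u], where [S u = u \o g]. *)
Definition act (K : comNzRingType) (T : Type) (g : T -> T) (p : {poly K})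
    (u : T -> K) (x : T) : K :=
  \sum_(i < size p) p`_i * u (iter i g x).

Section Act.
Context {K : comNzRingType} {T : Type} (g : T -> T).
Implicit Types (p q : {poly K}) (u v : T -> K).

Lemma act_widen p u x m : (size p <= m)%N ->
  act g p u x = \sum_(i < m) p`_i * u (iter i g x).
Proof.
move=> pm; rewrite /act (big_ord_widen m (fun i => p`_i * u (iter i g x))) //.
rewrite big_mkcond; apply: eq_bigr => i _; case: ltnP => // ip.
by rewrite nth_default ?mul0r.
Qed.

Lemma eq_act p u v : u =1 v -> act g p u =1 act g p v.
Proof. by move=> uv x; apply: eq_bigr => i _; rewrite uv. Qed.

Lemma act0 p u x : (forall y, u y = 0) -> act g p u x = 0.
Proof. by move=> u0; rewrite /act big1 // => i _; rewrite u0 mulr0. Qed.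

Lemma actC c u x : act g c%:P u x = c * u x.
Proof. by rewrite (@act_widen _ _ _ 1%N) ?size_polyC_leq1// big_ord1 coefC. Qed.

Lemma actD p q u x : act g (p + q) u x = act g p u x + act g q u x.
Proof.
have le := size_polyD p q.
rewrite (act_widen _ _ le) (act_widen _ _ (leq_maxl (size p) (size q))).
rewrite (act_widen _ _ (leq_maxr (size p) (size q))) -big_split /=.
by apply: eq_bigr => i _; rewrite coefD mulrDl.
Qed.

Lemma actMX p u x : act g (p * 'X) u x = act g p u (g x).
Proof.
have le : (size (p * 'X)%R <= (size p).+1)%N.
  by apply: leq_trans (size_polyMleq _ _) _; rewrite size_polyX addn2.
rewrite (act_widen _ _ le) big_ord_recl coefMX eqxx mul0r add0r.
by apply: eq_bigr => i _; rewrite coefMX -iterSr.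
Qed.

Lemma actZr p c u x : act g p (fun y => c * u y) x = c * act g p u x.
Proof. by rewrite mulr_sumr; apply: eq_bigr => i _; rewrite mulrCA. Qed.

Lemma act_comp p u x : act g p (u \o g) x = act g p u (g x).
Proof. by apply: eq_bigr => i _; rewrite /= -iterS iterSr. Qed.

(** Horner induction on both factors. This makes functions a module over the polynomial ring, so
    divisibility and Bezout identities apply to kernels. *)
Lemma actM p q u x : act g (p * q) u x = act g p (act g q u) x.
Proof.
elim/poly_ind: p x => [|p c IH] x; first by rewrite mul0r -[0]/(0%:P) !actC !mul0r.
rewrite mulrDl !actD actC mulrAC !actMX IH; congr (_ + _).
elim/poly_ind: q {IH} x => [|q d IH] x.
  by rewrite mulr0 -[0]/(0%:P) !actC mul0r mulr0.
by rewrite mulrDr mulrA -polyCM !actD !actMX IH !actC mulrDr mulrA.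
Qed.

Lemma act_ker_mull p q u :
  (forall x, act g q u x = 0) -> forall x, act g (p * q) u x = 0.
Proof. by move=> qu x; rewrite actM act0. Qed.

Lemma actXsubC z u x : act g ('X - z%:P) u x = u (g x) - z * u x.
Proof. by rewrite actD -polyCN actC -['X]mul1r actMX actC mul1r mulNr. Qed.

End Act.

(** * Kernels of coprime factors, and reversal of orbits *)

Section Coprime.
Context {K : fieldType} {T : Type} (g : T -> T).
Implicit Types (p q : {poly K}) (u : T -> K).

Lemma act_coprime_split p q u : coprimep p q ->
  (forall x, act g (p * q) u x = 0) ->
  exists v w, [/\ forall x, u x = v x + w x, forall x, act g p v x = 0
    & forall x, act g q w x = 0].
Proof.
move=> /Bezout_eq1_coprimepP[[a b] /= ab1] pqu.
(* With [a * p + b * q = 1], the part killed by [p] is the one carrying the factor [q], and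
   conversely. *)
exists (act g (b * q) u), (act g (a * p) u); split => x.
- by rewrite addrC -actD ab1 -polyC1 actC mul1r.
- by rewrite -actM mulrCA (act_ker_mull b).
- by rewrite -actM mulrCA [q * p]mulrC (act_ker_mull a).
Qed.

Lemma act_coprime_eq0 p q u : coprimep p q ->
  (forall x, act g p u x = 0) -> (forall x, act g q u x = 0) ->
  forall x, u x = 0.
Proof.
move=> /Bezout_eq1_coprimepP[[a b] /= ab1] pu qu x.
rewrite -[u x]mul1r -(actC g) polyC1 -ab1 actD.
by rewrite (act_ker_mull a) // (act_ker_mull b) // addr0.
Qed.

(** For one factor, [u \o h - z^-1 u = - z^-1 ((u \o g - z u) \o h)], because [g \o h] is the
    identity; the other factors are peeled off by induction. *)
Lemma act_rev (h : T -> T) (s : seq K) u :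
  cancel h g -> 0 \notin s ->
  (forall x, act g (\prod_(z <- s) ('X - z%:P)) u x = 0) ->
  forall x, act h (\prod_(z <- map GRing.inv s) ('X - z%:P)) u x = 0.
Proof.
move=> hK; elim: s u => [|z s IH] u.
  by rewrite !big_nil -polyC1 => _ + x => /(_ x); rewrite !actC.
rewrite inE negb_or eq_sym => /andP[z0 s0]; rewrite big_cons => su x.
rewrite /= big_cons mulrC actM.
have E y : act h ('X - (z^-1)%:P) u y
    = - z^-1 * (act g ('X - z%:P) u \o h) y.
  by rewrite /= !actXsubC hK; field.
rewrite (eq_act h _ E) actZr act_comp IH ?mulr0// => y.
by rewrite -actM mulrC su.
Qed.

End Coprime.

(** * Growth and decay along orbits *)

(** Induction on the roots: [w = (S - z) u] obeys the bound already, and [u] solves the first-order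
    recurrence [u_(n+1) = z u_n + w_n]. *)
Lemma act_prod_decay (K : numFieldType) (T : Type) (g : T -> T) (s : seq K)
    (t : K) (u : T -> K) :
  all (fun z => `|z| < t) s ->
  (forall x, act g (\prod_(z <- s) ('X - z%:P)) u x = 0) ->
  forall x, exists C, forall n, `|u (iter n g x)| <= C * t ^+ n.
Proof.
elim: s u => [|z s IH] u /=.
  rewrite big_nil => _ su x; exists 0 => n.
  by rewrite -[u _]mul1r -(actC g) su normr0 mul0r.
rewrite big_cons => /andP[zt st] su x.
have [|C CP] := IH (act g ('X - z%:P) u) st _ x.
  by move=> y; rewrite -actM mulrC su.
have tz : 0 < t - `|z| by rewrite subr_gt0.
have C0 : 0 <= C.
  by have := le_trans (normr_ge0 _) (CP 0%N); rewrite expr0 mulr1.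
have t0 : 0 <= t by apply: le_trans (ltW zt).
(* This constant [D] dominates [|u x|] and satisfies [|z| D + C <= t D], which closes the induction
   on [n]. *)
exists (`|u x| + C / (t - `|z|)); elim=> [|n IHn].
  by rewrite expr0 mulr1 lerDl divr_ge0 // ltW.
have := CP n; rewrite actXsubC -iterS => CPn.
rewrite -[u _](subrK (z * u (iter n g x))).
apply: le_trans (ler_normD _ _) _.
apply: (@le_trans _ _ (C * t ^+ n + `|z| * ((`|u x| + C / (t - `|z|)) * t ^+ n))).
  by rewrite lerD // normrM ler_wpM2l.
rewrite [X in _ <= X](_ : _ =
  `|u x| * ((t - `|z|) * t ^+ n)
  + (C * t ^+ n + `|z| * ((`|u x| + C / (t - `|z|)) * t ^+ n))).
  by rewrite lerDr !mulr_ge0 ?exprn_ge0 // ltW.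
by rewrite exprS; field; rewrite gt_eqF.
Qed.

(* [a n / r ^+ n] grows at least linearly, at rate [1 / r]. *)
Lemma geom_growth (R : archiRealFieldType) (r : R) (a b : nat -> R) (n0 : nat) :
  0 < r -> (forall n, a n.+1 = r * a n + b n) ->
  (forall n, (n0 <= n)%N -> r ^+ n <= b n) ->
  exists n1, forall n, (n1 <= n)%N -> r ^+ n <= a n.
Proof.
move=> r0 aS br.
have rX n : 0 < r ^+ n by rewrite exprn_gt0.
pose c := a n0 / r ^+ n0.
have lin m : (c + m%:R / r) * r ^+ (m + n0) <= a (m + n0)%N.
  elim: m => [|m IH]; first by rewrite mul0r addr0 /c divfK// gt_eqF.
  rewrite addSn aS; apply: le_trans (lerD (ler_wpM2l (ltW r0) IH) (br _ _)).
    rewrite -natr1 exprS le_eqVlt; apply/orP; left; apply/eqP; field.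
    by rewrite gt_eqF.
  exact: leq_addl.
(* From [m0] on, the linear factor [c + m / r] is at least 1. *)
pose m0 := Num.bound `|(1 - c) * r|.
exists (m0 + n0)%N => n n1n.
have /subnK <- : (n0 <= n)%N by apply: leq_trans n1n; rewrite leq_addl.
apply: le_trans (lin _); rewrite ler_peMl ?(ltW (rX _))// -lerBlDl ler_pdivlMr//.
have m0n : (m0 <= n - n0)%N by rewrite leq_subRL ?(leq_trans _ n1n) ?leq_addl// addnC.
apply: le_trans (ler_norm _) _; apply: (@le_trans _ _ m0%:R); last by rewrite ler_nat.
exact/ltW/archi_boundP.
Qed.

Lemma ReM_real (R : realType) (a : R) (z : R[i]) :
  complex.Re (a%:C * z) = a * complex.Re z.
Proof. by case: z => x y /=; rewrite mul0r subr0. Qed.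

Lemma ReD (R : realType) (y z : R[i]) :
  complex.Re (y + z) = complex.Re y + complex.Re z.
Proof. by case: y; case: z. Qed.

(** Induction on [k] through [w = (S - r) u]. If [w] vanishes along the orbit, [u] is geometric
    there and [s = (u x)^-1] serves; otherwise the direction [s] found for [w] also serves for [u],
    by [geom_growth]. *)
Lemma act_expXsubC_growth (R : realType) (T : Type) (g : T -> T) (r : R) (k : nat)
    (u : T -> R[i]) :
  0 < r -> (forall x, act g (('X - r%:C%:P) ^+ k) u x = 0) ->
  forall x, (forall n, u (iter n g x) = 0) \/
    exists s n0, forall n, (n0 <= n)%N -> r ^+ n <= complex.Re (s * u (iter n g x)).
Proof.
move=> r0; elim: k u => [|k IH] u uk x.
  by left => n; rewrite -[LHS]mul1r -(actC g) polyC1 -(expr0 ('X - r%:C%:P)) uk.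
have [y|w0|[s [n0 sP]]] := IH (act g ('X - r%:C%:P) u) _ x.
- by rewrite -actM -exprSr.
- have uE n : u (iter n g x) = (r ^+ n)%:C * u x.
    elim: n => [|n IHn]; first by rewrite mul1r.
    have /eqP := w0 n; rewrite actXsubC subr_eq0 iterS IHn => /eqP ->.
    by rewrite mulrA -rmorphM exprS.
  have [ux0|ux0] := eqVneq (u x) 0; first by left => n; rewrite uE ux0 mulr0.
  by right; exists (u x)^-1, 0%N => n _; rewrite uE mulrCA mulVf// ReM_real mulr1.
- right; exists s.
  apply: (@geom_growth _ r _ (fun n => complex.Re (s * (u (iter n.+1 g x)
     - r%:C * u (iter n g x)))) n0) => // [n|n /sP]; last by rewrite actXsubC.
  by rewrite -ReM_real -ReD; congr complex.Re; ring.
Qed.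

(** Finitely many moduli below [r] leave a gap, which a geometric comparison with ratio less than 1
    requires. *)
Lemma lt_strict_bound (R : realType) (r : R) (s : seq R[i]) : 0 < r ->
  all (fun z => `|z| < r%:C) s ->
  exists2 t, 0 <= t < r & all (fun z => `|z| < t%:C) s.
Proof.
move=> r0; elim: s => [|z s IH] /=; first by exists 0; rewrite ?lexx.
move=> /andP[zr /IH[t /andP[t0 tr] st]].
move: zr; rewrite normc_def ltcR; set m := Num.sqrt _ => mr.
exists (Num.max t ((m + r) / 2)).
  by rewrite le_max t0 gt_max tr /=; lra.
rewrite ltcR lt_max; apply/andP; split; first by apply/orP; right; lra.
by apply: sub_all st => y yt; apply: lt_le_trans yt _; rewrite lecR le_max lexx.
Qed.

Lemma geom_dominated (R : realType) (C t r : R) : 0 <= t < r ->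
  exists n0, forall n, (n0 <= n)%N -> C * t ^+ n < r ^+ n.
Proof.
move=> /andP[t0 tr]; have r0 := le_lt_trans t0 tr.
(* The tolerance is positive even for [C = 0], and yields [(1 + |C|) t^n < r^n]. *)
have /cvgrPdist_lt/(_ (1 + `|C|)^-1) : (fun n => (t / r) ^+ n) @ \oo --> (0 : R).
  by apply: cvg_expr; rewrite ger0_norm ?divr_ge0 ?(ltW r0)// ltr_pdivrMr// mul1r.
have C0 : 0 < 1 + `|C| by rewrite ltr_pwDl.
rewrite invr_gt0 => /(_ C0)[n0 _ n0P]; exists n0 => n /n0P /=.
rewrite sub0r normrN ger0_norm ?exprn_ge0 ?divr_ge0 ?(ltW r0)//.
rewrite expr_div_n ltr_pdivrMr ?exprn_gt0// mulrC ltr_pdivlMr// => h.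
have := ler_norm C; have : 0 <= t ^+ n by rewrite exprn_ge0.
by nra.
Qed.

(** * Removing the positive root from alternating sequences *)

Lemma act_alternating (R : realType) (T : Type) (g : T -> T) (r : R) (k : nat)
    (s : seq R[i]) (d : T -> R) :
  0 < r -> all (fun z => `|z| < r%:C) s ->
  (forall x, d x * d (g x) <= 0) ->
  (forall x, act g (('X - r%:C%:P) ^+ k * \prod_(z <- s) ('X - z%:P))
    (fun y => (d y)%:C) x = 0) ->
  forall x, act g (\prod_(z <- s) ('X - z%:P)) (fun y => (d y)%:C) x = 0.
Proof.
move=> r0 sr dd dP.
have [t tr st] := lt_strict_bound r0 sr.
have cop : coprimep (('X - r%:C%:P) ^+ k) (\prod_(z <- s) ('X - z%:P)).
  rewrite coprimep_expl// coprimep_sym coprimep_XsubC root_prod_XsubC.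
  apply/negP => /(allP sr); rewrite normc_def ltcR /= expr0n addr0 sqrtr_sqr.
  by rewrite ltNge ler_norm.
have [u [v [duv uP vP]]] := act_coprime_split cop dP.
have u0 x : u x = 0.
  have [/(_ 0%N)//|[c [n0 cP]]] := act_expXsubC_growth r0 uP x.
  have [C CP] := act_prod_decay st vP x.
  (* [|c| * C] is a nonnegative real seen as a complex number; its real part is the constant of a
     real comparison. *)
  have [n1 n1P] := geom_dominated (complex.Re (`|c| * C)) tr.
  have pos n : (n0 + n1 <= n)%N -> 0 < complex.Re c * d (iter n g x).
    move=> n01.
    have n0n : (n0 <= n)%N by rewrite (leq_trans _ n01) ?leq_addr.
    have n1n : (n1 <= n)%N by rewrite (leq_trans _ n01) ?leq_addl.
    (* As [d] is real, [Re (c d) = Re c * d]: the complex direction [c] turns into a fixed real sign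
       for [d]. *)
    have -> : complex.Re c * d (iter n g x)
        = complex.Re (c * u (iter n g x)) + complex.Re (c * v (iter n g x)).
      by rewrite -ReD -mulrDr -duv mulrC -ReM_real mulrC.
    rewrite -ltrBlDr sub0r; apply: lt_le_trans (cP _ n0n); apply: le_lt_trans (n1P _ n1n).
    apply: le_trans (ler_norm _) _; rewrite normrN.
    rewrite -lecR; apply: le_trans (normc_ge_Re _) _; rewrite normrM.
    have le : `|c| * `|v (iter n g x)| <= `|c| * C * (t ^+ n)%:C.
      by rewrite -mulrA ler_wpM2l// rmorphXn; exact: CP.
    apply: le_trans le _; rewrite rmorphM /= ler_wpM2r//.
      by rewrite ler0c exprn_ge0//; case/andP: tr.
    rewrite RRe_real// ger0_real// mulr_ge0//.
    by have := le_trans (normr_ge0 _) (CP 0%N); rewrite expr0 mulr1.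
  (* Positivity at two consecutive points contradicts [d * (d \o g) <= 0]. *)
  have := mulr_gt0 (pos _ (leqnn _)) (pos _ (leqnSn _)).
  by rewrite mulrACA ltNge mulr_ge0_le0 ?dd// -expr2 sqr_ge0.
by move=> x; rewrite (eq_act g _ (v := v)) ?vP// => y; rewrite duv u0 add0r.
Qed.

Lemma prod_XsubC_nseq_cat (K : comNzRingType) (c : K) (k : nat) (s : seq K) :
  \prod_(z <- nseq k c ++ s) ('X - z%:P)
    = ('X - c%:P) ^+ k * \prod_(z <- s) ('X - z%:P).
Proof. by rewrite big_cat big_nseq /= iter_mulr_1. Qed.

(* When the roots in [s] have modulus larger than [r], the alternating sequences
   are followed backwards, along [h]. *)
Lemma act_alternating_sided (R : realType) (T : Type) (g h : T -> T) (r : R) (k : nat)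
    (s : seq R[i]) (d : T -> R) :
  cancel g h -> cancel h g -> 0 < r -> 0 \notin s ->
  all (fun z => `|z| < r%:C) s \/ all (fun z => r%:C < `|z|) s ->
  (forall x, d x * d (g x) <= 0) ->
  (forall x, act g (('X - r%:C%:P) ^+ k * \prod_(z <- s) ('X - z%:P))
    (fun y => (d y)%:C) x = 0) ->
  forall x, act g (\prod_(z <- s) ('X - z%:P)) (fun y => (d y)%:C) x = 0.
Proof.
move=> gK hK r0 s0 [sr|sr] dd dP; first exact: act_alternating dP.
have rC0 : r%:C != 0 :> R[i] by rewrite (inj_eq (@complexI R)) gt_eqF.
(* The conclusion is proved for [h] with inverted roots, then reversed back to [g]. *)
rewrite -[s](mapK (@invrK _)); apply: (act_rev gK).
  by rewrite -[0]invr0 mem_map//; exact: invr_inj.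
apply: (@act_alternating _ _ h r^-1 k); rewrite ?invr_gt0//.
- rewrite all_map; apply: sub_all sr => z /= rz.
  have z0 : 0 < `|z| by apply: lt_trans rz; rewrite ltcR.
  by rewrite normfV fmorphV ltf_pV2// posrE ltcR.
(* Alternation along [h] at [x] is alternation along [g] at [h x]. *)
- by move=> x; rewrite mulrC -[X in _ * d X]hK.
- move=> x; rewrite fmorphV -prod_XsubC_nseq_cat -map_nseq -map_cat; apply: (act_rev hK).
    rewrite mem_cat negb_or s0 andbT; apply/negP => /nseqP[r00 _].
    by rewrite -r00 eqxx in rC0.
  by move=> y; rewrite prod_XsubC_nseq_cat.
Qed.

(** * From sets of roots to factorisations *)

Lemma closed_field_poly_roots (K : closedFieldType) (p : {poly K}) : p != 0 ->
  exists s c, [/\ c != 0, p = c *: \prod_(z <- s) ('X - z%:P)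
    & forall z, count_mem z s = mup z p].
Proof.
move=> p0; have [s pE] := closed_field_poly_normal p.
have c0 : lead_coef p != 0 by rewrite lead_coef_eq0.
exists s, (lead_coef p); split=> // z.
by rewrite [in RHS]pE -mul_polyC mupMr ?mu_prod_XsubC// rootC.
Qed.

(** On the subtype of points of [I], [g] becomes a total self-map [G], so the equation on [I] is an
    identity at every point; the embedding into the complex numbers is injective and the scalar [a]
    cancels. *)
Lemma iterative_eqP (R : realType) (I : set R) (g : R -> R) (G : {x | I x} -> {x | I x})
    (K : nat) (c : nat -> R) (s : seq R[i]) (a : R[i]) :
  (forall x, sval (G x) = g (sval x)) -> a != 0 ->
  map_poly (real_complex R) (\poly_(i < K.+1) c i)
    = a *: \prod_(z <- s) ('X - z%:P) ->
  iterative_eq I K c g <->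
  forall x, act G (\prod_(z <- s) ('X - z%:P)) (fun y => (sval y)%:C) x = 0.
Proof.
move=> Gg a0 cE.
have iterG i x : sval (iter i G x) = iter i g (sval x).
  by elim: i => //= i <-.
have E x : (\sum_(i < K.+1) c i * iter i g (sval x))%:C
    = a * act G (\prod_(z <- s) ('X - z%:P)) (fun y => (sval y)%:C) x.
  rewrite -[RHS](@actC _ _ G _ (act G _ _)) -actM mul_polyC -cE.
  rewrite (@act_widen _ _ _ _ _ _ K.+1); last first.
    by rewrite size_map_poly size_poly.
  rewrite rmorph_sum; apply: eq_bigr => i _.
  by rewrite coef_map coef_poly ltn_ord iterG rmorphM.
split=> [cI x|cI x Ix].
  have := E x; rewrite cI; last exact: (proj2_sig x).
  by move/esym/eqP; rewrite mulf_eq0 (negPf a0) => /eqP.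
by apply: (@complexI R); rewrite (E (exist _ x Ix)) cI mulr0.
Qed.

(** [L] stands for the pairs shared by [A] and [B]. The boolean [r == 1] serves as a length, so that
    the extra root 1 of case (ii) appears once or not at all. Multisets are compared by counting
    each [z]. *)
Lemma roots_match (K : fieldType) (A B : {poly K}) (r : K) (k : nat)
    (L : K -> nat -> Prop) (sA sB : seq K) :
  A != 0 -> (forall z m, L z m -> z != r) ->
  (forall z m, (root A z /\ m = mup z A) <-> (z = r /\ m = k) \/ L z m) ->
  (forall z m, (root B z /\ m = mup z B) <->
    (r = 1 /\ z = 1 /\ m = 1%N) \/ L z m) ->
  (forall z, count_mem z sA = mup z A) -> (forall z, count_mem z sB = mup z B) ->
  let s := [seq z <- sA | z != r] in
  [/\ perm_eq sA (nseq k r ++ s), perm_eq sB (nseq (r == 1) 1 ++ s)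
    & (0 < k)%N].
Proof.
move=> A0 Lr aP bP cA cB s.
have [rA kA] : root A r /\ k = mup r A by apply/aP; left.
have count_s z : count_mem z s = if z == r then 0%N else mup z A.
  rewrite /s count_filter -cA; case: ifPn => [/eqP->|zr].
    by apply/eqP; rewrite -leqn0 leqNgt -has_count; apply/hasPn => y _ /=; case: eqP.
  by apply: eq_count => y /=; case: eqP => // ->; rewrite zr.
split.
- rewrite /perm_eq; apply/allP => z _ /=; rewrite count_cat count_nseq count_s cA /=.
  by have [->|zr] := eqVneq z r; rewrite ?mul1n ?addn0 ?kA ?mul0n.
- rewrite /perm_eq; apply/allP => z _ /=; rewrite count_cat count_nseq count_s cB /=.
  have [zr|zr] := eqVneq z r.
    have [r1|r1] := eqVneq r 1.
      have [_ m1] : root B 1 /\ 1%N = mup 1 B by apply/bP; left.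
      by rewrite zr r1 -m1 eqxx.
    have zB : ~~ root B z.
      apply/negP => zB; have /bP : root B z /\ mup z B = mup z B by [].
      by move=> [[/eqP]|/Lr]; rewrite ?(negPf r1)// zr eqxx.
    by rewrite mupNroot// muln0.
  have -> : ((1%R == z) * (r == 1%R) = 0)%N.
    by case: eqVneq => // z1; case: eqVneq => // r1; rewrite -z1 r1 eqxx in zr.
  rewrite add0n; have [zA|zA] := boolP (root A z).
    have /aP : root A z /\ mup z A = mup z A by [].
    move=> [[/eqP]|Lz]; first by rewrite (negPf zr).
    by have [_ <-] : root B z /\ mup z A = mup z B by apply/bP; right.
  rewrite (mupNroot zA) mupNroot//; apply/negP => zB.
  have /bP : root B z /\ mup z B = mup z B by [].
  move=> [[r1 [z1 _]]|Lz]; first by rewrite z1 r1 eqxx in zr.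
  have [zA' _] : root A z /\ mup z B = mup z A by apply/aP; right.
  by rewrite zA' in zA.
- by rewrite kA -XsubC_dvd// dvdp_XsubCl.
Qed.

(** * Equivalence of the two equations for a positive extreme root *)

Lemma iterative_eq_reduce (R : realType) (I : set R) (N M : nat) (a b : nat -> R)
    (r : R) (k : nat) (L : R[i] -> nat -> Prop) (g : R -> R) :
  let A := map_poly (real_complex R) (\poly_(i < N.+1) a i) in
  let B := map_poly (real_complex R) (\poly_(i < M.+1) b i) in
  a 0%N != 0 -> a N != 0 -> b M != 0 -> 0 < r ->
  (forall z m, L z m -> `|z| < r%:C) \/ (forall z m, L z m -> r%:C < `|z|) ->
  (forall z m, (root A z /\ m = mup z A) <-> (z = r%:C /\ m = k) \/ L z m) ->
  (forall z m, (root B z /\ m = mup z B) <->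
    (r%:C = 1 /\ z = 1 /\ m = 1%N) \/ L z m) ->
  set_fun I I g -> set_surj I I g ->
  (forall x y, I x -> I y -> x <= y -> g y <= g x) ->
  iterative_eq I N a g <-> iterative_eq I M b g.
Proof.
move=> A B a0 aN bM r_gt0 L_sided aP bP gI gS g_anti.
have poly_neq0 (c : nat -> R) n : c n != 0 ->
    map_poly (real_complex R) (\poly_(i < n.+1) c i) != 0.
  by move=> cn; rewrite map_poly_eq0 -lead_coef_eq0 lead_coef_poly.
have A0 : A != 0 := poly_neq0 _ _ aN.
have B0 : B != 0 := poly_neq0 _ _ bM.
have root0 : ~~ root A 0.
  by rewrite rootE horner_coef0 coef_map coef_poly /= fmorph_eq0.
have [sA [cA [cA0 AE countA]]] := closed_field_poly_roots A0.
have [sB [cB [cB0 BE countB]]] := closed_field_poly_roots B0.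
have Lr z m : L z m -> z != r%:C.
  move=> Lz; apply/eqP => zr.
  have rE : `|r%:C| = r%:C :> R[i] by rewrite ger0_norm// lecR ltW.
  by case: L_sided => /(_ _ _ Lz); rewrite zr rE ltxx.
have [pA pB k_gt0] := roots_match A0 Lr aP bP countA countB.
set s := [seq z <- sA | z != r%:C] in pA pB.
pose T := {x | I x}.
pose G (x : T) : T := exist _ (g (sval x)) (gI _ (proj2_sig x)).
have Gg x : sval (G x) = g (sval x) by [].
have iA := iterative_eqP Gg cA0 AE; have iB := iterative_eqP Gg cB0 BE.
pose id_ (y : T) := (sval y)%:C : R[i].
rewrite (perm_big _ pA) prod_XsubC_nseq_cat -/id_ in iA.
rewrite (perm_big _ pB) prod_XsubC_nseq_cat -/id_ in iB.
(* The easy direction: the second characteristic polynomial divides the first up to a scalar. When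
   [r = 1], its factor [X - 1] is taken from [(X - r)^k], as [0 < k]. *)
split; last first.
  move=> /iB sol; apply/iA => x.
  have [r1|r1] := eqVneq r%:C 1; last first.
    by apply: act_ker_mull => y; have := sol y; rewrite (negPf r1) expr0 mul1r.
  rewrite -(prednK k_gt0) exprSr -mulrA; apply: act_ker_mull => y.
  by have := sol y; rewrite r1 eqxx expr1.
move=> asol; have sol := iA.1 asol; apply/iB.
(* Since [a 0] is nonzero, the equation recovers [x] from [g x] and its iterates. *)
have inj x y : I x -> I y -> g x = g y -> x = y.
  move=> Ix Iy gxy; have := etrans (asol x Ix) (esym (asol y Iy)).
  have tailE (i : 'I_N) : iter (lift ord0 i) g x = iter (lift ord0 i) g y.
    by rewrite lift0 !iterSr gxy.
  rewrite !big_ord_recl; under eq_bigr do rewrite tailE.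
  by move=> e; apply: (mulfI a0); apply: addIr e.
have subtype_inj (u v : T) : sval u = sval v -> u = v.
  by case: u v => [u Iu] [v Iv] /= uv; exact: eq_exist.
have surj (x : T) : exists y, G y = x.
  have [y Iy gy] := gS _ (proj2_sig x).
  by exists (exist _ y Iy); apply: subtype_inj.
have [H HK] := choice surj.
have GK : cancel G H.
  move=> x; have /(congr1 sval) := HK (G x); rewrite !Gg => e.
  by apply: subtype_inj; apply: inj e; exact: proj2_sig.
pose d (x : T) := sval (G x) - sval x.
have dE x : (d x)%:C = act G ('X - 1%:P) id_ x.
  by rewrite actXsubC mul1r /d rmorphB.
(* Applying the antitone [g] to [x <= g x] or to [g x <= x] reverses the inequality. *)
have dd x : d x * d (G x) <= 0.
  have anti (y z : T) : sval y <= sval z -> sval (G z) <= sval (G y).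
    by apply: g_anti; exact: proj2_sig.
  rewrite /d; have [xG|Gx] := leP (sval x) (sval (G x)).
    by rewrite mulr_ge0_le0 ?subr_ge0 ?subr_le0// anti.
  by rewrite mulr_le0_ge0 ?subr_ge0 ?subr_le0 ?anti// ltW.
have sL z : z \in s -> exists m, L z m.
  rewrite mem_filter /= -has_pred1 has_count countA -XsubC_dvd//.
  rewrite dvdp_XsubCl => /andP[zr zA].
  have /aP : root A z /\ mup z A = mup z A by [].
  by move=> [[/eqP]|]; [rewrite (negPf zr)|exists (mup z A)].
have s0 : 0 \notin s.
  rewrite mem_filter negb_and orbC -has_pred1 has_count countA -XsubC_dvd//.
  by rewrite dvdp_XsubCl root0.
have dsol : forall x, act G (\prod_(z <- s) ('X - z%:P)) (fun y => (d y)%:C) x = 0.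
  apply: (act_alternating_sided GK HK r_gt0 s0 _ dd (k := k)).
    by case: L_sided => h; [left|right]; apply/allP => z /sL[m]; exact: h.
  (* The full polynomial kills the identity, hence also [d], its image under [S - 1]. *)
  by move=> x; rewrite (eq_act G _ dE) -actM mulrC; apply: act_ker_mull.
have sol1 x : act G ('X - 1%:P) (act G (\prod_(z <- s) ('X - z%:P)) id_) x = 0.
  by rewrite -actM mulrC actM -(eq_act G _ dE) dsol.
have [r1|r1] := eqVneq r%:C 1; first by move=> x; rewrite expr1 actM.
rewrite expr0 mul1r.
(* The image of the identity under the cofactor is killed by [X - 1] and by [(X - r)^k], which are
   coprime as [r] is not 1. *)
apply: (@act_coprime_eq0 _ _ G ('X - 1%:P) (('X - r%:C%:P) ^+ k)) => //.
  by rewrite coprimep_sym coprimep_expl// coprimep_XsubC root_XsubC eq_sym.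
by move=> x; rewrite -actM.
Qed.


(** * Reduction to the positive root among [r1] and [r2] *)

Theorem theorem4p2 (R : realType) (I : set R)
  (hI : is_interval I)
  (hI_nondeg : exists x y, [/\ I x, I y & x < y])
  (N : nat) (hN : (1 <= N)%N) (a : nat -> R)
  (ha0 : a 0%N != 0) (haN : a N != 0)
  (r1 r2 : R) (k1 k2 : nat)
  (p : nat) (lam : 'I_p -> R[i]) (l : 'I_p -> nat)
  (hRa : roots_mult N a =
    [set (r1%:C, k1); (r2%:C, k2)] `|` range (fun i => (lam i, l i)))
  (hr1_r2 : `|r1| < `|r2|)
  (hr1_lam : forall i, `|r1%:C| < `|lam i|)
  (hlam : forall i j : 'I_p, (i <= j)%N -> `|lam i| <= `|lam j|)
  (hlam_r2 : forall i, `|lam i| < `|r2%:C|)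
  (hr12 : r1 * r2 < 0)
  (rj : R) (kj : nat)
  (hj : (rj, kj) = (r1, k1) \/ (rj, kj) = (r2, k2))
  (hrj : rj < 0)
  (M : nat) (b : nat -> R) (hbM : b M != 0)
  (hRb_i : r1 <> 1 /\ r2 <> 1 ->
    roots_mult M b =
      [set (rj%:C, kj)] `|` range (fun i => (lam i, l i)))
  (hRb_ii : r1 = 1 \/ r2 = 1 ->
    roots_mult M b =
      [set (1, 1%N); (rj%:C, kj)] `|` range (fun i => (lam i, l i)))
  (g : R -> R)
  (hg : continuous_decreasing_surjection I g) :
  iterative_eq I N a g <-> iterative_eq I M b g.
Proof.
have [gI gS _ g_anti] := hg.
(* The negative root joins the [lam i]: these are the pairs kept in both cases (i) and (ii). *)
set L := fun z m => (z = rj%:C /\ m = kj) \/ exists i, lam i = z /\ l i = m.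
have LP z m : L z m <->
    ([set (rj%:C, kj)] `|` range (fun i => (lam i, l i))) (z, m).
  split=> [[[-> ->]|[i [<- <-]]]|[[-> ->]|[i _ [<- <-]]]].
  - by left.
  - by right; exists i.
  - by left.
  - by right; exists i.
have normC (x : R) : `|x%:C| = `|x|%:C by rewrite normc_def /= expr0n addr0 sqrtr_sqr.
(* Here [r] is the positive root: [r2], of largest modulus, if [rj] is [r1], and [r1], of smallest
   modulus, if [rj] is [r2]. *)
suff [r [k [r0 L_sided aP rP]]] : exists r k, [/\ 0 < r,
    (forall z m, L z m -> `|z| < r%:C) \/ (forall z m, L z m -> r%:C < `|z|),
    forall z m, roots_mult N a (z, m) <-> (z = r%:C /\ m = k) \/ L z m
    & (r = 1) <-> (r1 = 1 \/ r2 = 1)].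
  apply: (@iterative_eq_reduce _ _ _ _ _ _ r k L) => // z m.
  have [/[dup] r1E /rP/hRb_ii bE|r1N] := pselect (r = 1).
    rewrite (_ : (_ /\ _) = roots_mult M b (z, m))// bE r1E.
    split=> [[[[-> ->]|h]|h]|[[_ [-> ->]]|/LP[h|h]]].
    - by left.
    - by right; apply/LP; left.
    - by right; apply/LP; right.
    - by left; left.
    - by left; right.
    - by right.
  rewrite (_ : (_ /\ _) = roots_mult M b (z, m))// hRb_i -?LP; last first.
    by split=> e; apply: r1N; apply/rP; [left|right].
  by split=> [|[[/(@complexI R)]|]]//; right.
have sub z m : roots_mult N a (z, m) <-> (z = r1%:C /\ m = k1) \/
    (z = r2%:C /\ m = k2) \/ exists i, lam i = z /\ l i = m.
  rewrite hRa; split=> [[[[-> ->]|[-> ->]]|[i _ [<- <-]]]|[[-> ->]|[[-> ->]|[i [<- <-]]]]].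
  - by left.
  - by right; left.
  - by right; right; exists i.
  - by left; left.
  - by left; right.
  - by right; exists i.
case: hj => -[rjE kjE]; rewrite /L rjE kjE.
- have r2_gt0 : 0 < r2 by rewrite -(nmulr_rlt0 _ hrj) rjE.
  have r2E : `|r2| = r2 by rewrite gtr0_norm.
  exists r2, k2; split=> //.
  + left=> z m [[-> _]|[i [<- _]]]; first by rewrite normC ltcR -[ltRHS]r2E.
    by rewrite -[r2 in ltRHS]r2E -normC.
  + by move=> z m; rewrite sub; tauto.
  + by split=> [|[] // r11]; [right|move: hrj; rewrite rjE r11 ltr10].
- have r1_gt0 : 0 < r1 by rewrite -(nmulr_llt0 _ hrj) rjE.
  have r1E : `|r1| = r1 by rewrite gtr0_norm.
  exists r1, k1; split=> //.
  + right=> z m [[-> _]|[i [<- _]]]; first by rewrite normC ltcR -[ltLHS]r1E.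
    by rewrite -[r1 in ltLHS]r1E -normC.
  + by split=> [|[] // r21]; [left|move: hrj; rewrite rjE r21 ltr10].
Qed.
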